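(* Let $\mathcal{P}$ be a fixed hyper-prior, $\delta>0$, and $\lambda_1,\dots,\lambda_n>0$ fixed. Then with probability at least $1-\delta$ over the sampling of $S_1,\dots,S_n$, simultaneously for all hyper-posteriors $\mathcal{Q}$ and all posteriors $Q_1,\dots,Q_n$, $$-\sum_{i=1}^n m_i\log\Big(1-\mathcal{R}_i(Q_i)+\mathcal{R}_i(Q_i)\,e^{-\frac{\lambda_i}{n m_i}}\Big)\;\le\;\frac1n\sum_{i=1}^n\lambda_i\,\widehat{\mathcal{R}}_i(Q_i)+\mathrm{KL}(\mathfrak{Q}\|\mathfrak{P})+\log\frac1\delta.$$
   Context: Multi-task setting: $n$ tasks; task $i$ has an unknown distribution $D_i$ on $\mathcal{Z}$, a loss $\ell_i:\mathcal{F}\times\mathcal{Z}\to[0,1]$, and a training set $S_i=(z_{i1},\dots,z_{im_i})$ of $m_i\ge1$ i.i.d. samples from $D_i$, the $S_i$ mutually independent. $\mathcal{M}(\mathcal{F})$ is the set of probability distributions on $\mathcal{F}$. For $Q\in\mathcal{M}(\mathcal{F})$: $\ell_i(Q,z)=\mathbb{E}_{f\sim Q}\ell_i(f,z)$, $\mathcal{R}_i(Q)=\mathbb{E}_{z\sim D_i}\ell_i(Q,z)$, $\widehat{\mathcal{R}}_i(Q)=\frac1{m_i}\sum_{j=1}^{m_i}\ell_i(Q,z_{ij})$. Hyper-prior $\mathcal{P}$ (data-independent) and hyper-posterior $\mathcal{Q}$ are distributions on $\mathcal{M}(\mathcal{F})$; posteriors $Q_i\in\mathcal{M}(\mathcal{F})$;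 $\mathcal{Q},Q_i$ may depend on the data. $\mathfrak{Q}=\mathcal{Q}\times Q_1\times\cdots\times Q_n$ on $\mathcal{M}(\mathcal{F})\times\mathcal{F}^n$; $\mathfrak{P}$ on the same space is generated by $P\sim\mathcal{P}$, then $f_1,\dots,f_n$ i.i.d. $\sim P$. $\mathrm{KL}$ is the Kullback–Leibler divergence. *)

(* Defs.v *)
From HB Require Import structures.
From mathcomp Require Import all_boot all_order all_algebra.
From mathcomp Require Import all_classical all_reals all_analysis.

Set Implicit Arguments.
Unset Strict Implicit.
Unset Printing Implicit Defensive.

Import Order.TTheory GRing.Theory Num.Theory.
Local Open Scope classical_set_scope.
Local Open Scope ring_scope.

Definition is_density d (T : measurableType d) (R : realType)
  (mu nu : probability T R) (f : T -> R) : Prop :=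
  [/\ measurable_fun [set: T] f, (forall x, 0 <= f x) &
      forall A, measurable A -> mu A = (\int[nu]_(x in A) (f x)%:E)%E].

Definition KL d (T : measurableType d) (R : realType)
  (mu nu : probability T R) : \bar R :=
  match pselect (exists f, is_density mu nu f) with
  | left H => let f := projT1 (cid H) in
              (\int[nu]_x (f x * ln (f x))%:E)%E
  | right _ => +oo%E
  end.

Definition lossQ dF dZ (F : measurableType dF) (Z : measurableType dZ)
  (R : realType) (l : F -> Z -> R) (Q : probability F R) (z : Z) : R :=
  fine (\int[Q]_f (l f z)%:E)%E.

Definition risk dF dZ (F : measurableType dF) (Z : measurableType dZ)
  (R : realType) (l : F -> Z -> R) (D : probability Z R)
  (Q : probability F R) : R :=
  fine (\int[D]_z (lossQ l Q z)%:E)%E.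

Definition emp_risk dF dZ (F : measurableType dF) (Z : measurableType dZ)
  (R : realType) (l : F -> Z -> R) (m : nat) (S : 'I_m -> Z)
  (Q : probability F R) : R :=
  (m%:R)^-1 * \sum_(j < m) lossQ l Q (S j).

Definition sample_index (n : nat) (m : 'I_n -> nat) :=
  {i : 'I_n & 'I_(m i)}.

Definition iid_samples dO dZ (Omega : measurableType dO)
  (Z : measurableType dZ) (R : realType) (P : probability Omega R)
  (n : nat) (m : 'I_n -> nat) (D : 'I_n -> probability Z R)
  (X : forall i : 'I_n, 'I_(m i) -> Omega -> Z) : Prop :=
  [/\ (forall i j, measurable_fun [set: Omega] (X i j)),
      (forall i j (A : set Z), measurable A -> P (X i j @^-1` A) = D i A) &
      (forall (J : {set sample_index m}) (A : sample_index m -> set Z),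
         (forall k, measurable (A k)) ->
         P (\bigcap_(k in [set k | k \in J]) (X (tag k) (tagged k) @^-1` A k))
         = (\prod_(k in J) P (X (tag k) (tagged k) @^-1` A k))%E)].

(* Measures on M(F) x F^n, where M(F) = pprobability F R (the space of       *)
(* probability measures on F with the sigma-algebra generated by the         *)
(* evaluation maps) and F^n = n.-tuple F.  Both are characterized by their   *)
(* values on measurable boxes A x B_1 x ... x B_n (a pi-system generating    *)
(* the product sigma-algebra, so this determines them uniquely).             *)
Definition box dF (F : measurableType dF) (n : nat) (B : 'I_n -> set F)
  : set (n.-tuple F) := [set t | forall i, B i (tnth t i)].

Definition is_frakQ dF (F : measurableType dF) (R : realType) (n : nat)
  (Qh : probability (pprobability F R) R) (Q : 'I_n -> probability F R)
  (QQ : probability (pprobability F R * n.-tuple F)%type R) : Prop :=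
  forall (A : set (pprobability F R)) (B : 'I_n -> set F),
    measurable A -> (forall i, measurable (B i)) ->
    QQ (A `*` box B) = (Qh A * \prod_(i < n) Q i (B i))%E.

(* frakP : P ~ Ph, then f_1, ..., f_n i.i.d. ~ P *)
Definition is_frakP dF (F : measurableType dF) (R : realType) (n : nat)
  (Ph : probability (pprobability F R) R)
  (PP : probability (pprobability F R * n.-tuple F)%type R) : Prop :=
  forall (A : set (pprobability F R)) (B : 'I_n -> set F),
    measurable A -> (forall i, measurable (B i)) ->
    PP (A `*` box B) =
      (\int[Ph]_(p in A) \prod_(i < n) (p : probability F R) (B i))%E.

(* Main.v *)
(* PAC-Bayes by exponential moments.  Convexity of exp gives, for fixed f,
   E exp (- a l(f, z)) <= 1 - (1 - exp (- a)) R(f); by independence of all the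
   samples, for fixed (P, f_1, ..., f_n) the exponential of
     V := sum_(i, j) (- ln (1 - (1 - exp (- a_i)) R_i(f_i)) - a_i l_i(f_i, z_ij)),
   where a_i = lambda_i / (n m_i), has expectation at most 1.  Integrating against
   frakP, exchanging the integrals and applying Markov's inequality yields an event
   of probability at least 1 - delta on which the frakP-integral of exp V is at most
   1 / delta.  On that event the Donsker-Varadhan inequality bounds the
   frakQ-integral of V for all posteriors at once, and Jensen's inequality for - ln
   moves the average over f_i inside the logarithm. *)
Require Import Defs.
From HB Require Import structures.
From mathcomp Require Import all_boot all_order all_algebra.
From mathcomp Require Import all_classical all_reals all_analysis.
From mathcomp Require Import measurable_realfun.
From mathcomp Require Import ring lra.

Import Order.TTheory GRing.Theory Num.Theory.
Local Open Scope classical_set_scope.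
Local Open Scope ring_scope.

(** * Change of measure: integrals against a weighted image measure *)

Section change_of_measure.
Set Implicit Arguments.
Unset Strict Implicit.
Local Open Scope ereal_scope.
Context d d' (T : measurableType d) (T' : measurableType d') (R : realType).
Variables (nu : {measure set T -> \bar R}) (rho : {measure set T' -> \bar R}).
Variables (X : T -> T') (W : T -> R) (c : R).
Hypotheses (mX : measurable_fun [set: T] X) (mW : measurable_fun [set: T] W).
Hypothesis W0 : forall x, (0 <= W x)%R.
Hypothesis WX : forall A, measurable A ->
  \int[nu]_(x in X @^-1` A) (W x)%:E = c%:E * rho A.

Import HBNNSimple.

(** By linearity over the level sets of [h], only indicators remain, and for those the identity is
    [WX]. *)
Let weighted_nnsfun (h : {nnsfun T' >-> R}) :
  \int[nu]_x ((h (X x))%:E * (W x)%:E) = c%:E * \int[rho]_y (h y)%:E.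
Proof.
have mh1 r : measurable_fun [set: T] (fun x => \1_(h @^-1` [set r]) (X x) : R).
  by apply: measurableT_comp mX; exact: measurable_indic.
rewrite integralT_nnsfun sintegralE ge0_mule_fsumr; last first.
  by move=> y; exact: nnsfun_mulemu_ge0.
transitivity (\int[nu]_x \sum_(y \in range h)
    (y%:E * (\1_(h @^-1` [set y]) (X x) * W x)%:E)).
  apply: eq_integral => x _.
  rewrite {1}(fimfunE h) -fsumEFin// ge0_mule_fsuml; last first.
    by move=> y; rewrite EFinM nnfun_muleindic_ge0.
  by apply: eq_fsbigr => y _; rewrite -!EFinM mulrA.
have mh2 r : measurable_fun [set: T]
    (fun x => (\1_(h @^-1` [set r]) (X x) * W x)%:E).
  exact/measurable_EFinP/measurable_funM.
rewrite ge0_integral_fsum//; last 2 first.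
- by move=> y; exact: measurable_funeM.
- by move=> y x _; rewrite EFinM muleA mule_ge0 ?lee_fin//; exact: nnfun_muleindic_ge0.
apply: eq_fsbigr => y; rewrite inE => -[z _ <-].
rewrite ge0_integralZl_EFin//; last by move=> x _; rewrite lee_fin mulr_ge0.
rewrite muleCA -WX//; congr (_ * _).
rewrite [RHS]integral_mkcond; apply: eq_integral => x _.
rewrite patchE indicE (_ : (x \in _) = (X x \in h @^-1` [set h z])).
  by case: ifPn => _; rewrite ?mul1r ?mul0r.
by apply/idP/idP; rewrite !inE.
Qed.

(** Monotone convergence along simple approximations of [f] passes to the limit on both sides. *)
Lemma ge0_integral_weighted (f : T' -> \bar R) :
  measurable_fun [set: T'] f -> (forall y, 0 <= f y) ->
  \int[nu]_x (f (X x) * (W x)%:E) = c%:E * \int[rho]_y f y.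
Proof.
move=> mf f0; pose h := nnsfun_approx measurableT mf.
have hf y : (EFin \o h n) y @[n --> \oo] --> f y by exact: cvg_nnsfun_approx.
have hn : {homo (fun n => h n : T' -> R) : a b / (a <= b)%N >-> forall y, (a y <= b y)%R}.
  by move=> a b ab y; exact/lefP/nd_nnsfun_approx.
have mhX n : measurable_fun [set: T] (fun x => h n (X x)).
  exact: measurableT_comp.
have cvr : \int[rho]_y (EFin \o h n) y @[n --> \oo] --> \int[rho]_y f y.
  rewrite (_ : f = fun y => limn (fun n => (EFin \o h n) y)); last first.
    by apply/funext => y; apply/esym/cvg_lim => //; exact: hf.
  apply: cvg_monotone_convergence => //.
  - by move=> n; exact/measurable_EFinP.
  - by move=> n y _; rewrite lee_fin.
  - by move=> y _ a b ab; rewrite lee_fin; exact: hn.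
have cvl : \int[nu]_x ((h n (X x))%:E * (W x)%:E) @[n --> \oo] -->
    \int[nu]_x (f (X x) * (W x)%:E).
  rewrite (_ : (fun x => f (X x) * _) =
      fun x => limn (fun n => (h n (X x))%:E * (W x)%:E)); last first.
    by apply/funext => x; apply/esym/cvg_lim => //; apply: cvgeZr => //; exact: hf.
  apply: (cvg_monotone_convergence (mu := nu) measurableT
    (g' := fun n x => (h n (X x))%:E * (W x)%:E)) => //.
  - by move=> n; exact/measurable_EFinP/measurable_funM.
  - by move=> n x _; rewrite lee_fin mulr_ge0.
  - by move=> x _ a b ab; rewrite lee_fin ler_wpM2r//; exact: hn.
have {}cvl : c%:E * \int[rho]_y (h n y)%:E @[n --> \oo] -->
    \int[nu]_x (f (X x) * (W x)%:E).
  by under eq_fun do rewrite -weighted_nnsfun.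
apply: (cvg_unique _ cvl) => //.
exact: cvgeZl cvr.
Qed.

End change_of_measure.

(** * Integrals of bounded functions *)

Section bounded_integrals.
Set Implicit Arguments.
Unset Strict Implicit.
Context d (T : measurableType d) (R : realType).

Lemma ler_norm_integrable (mu : {measure set T -> \bar R}) (f g : T -> R) :
  measurable_fun [set: T] f -> (forall x, `|f x| <= g x) ->
  mu.-integrable [set: T] (EFin \o g) -> mu.-integrable [set: T] (EFin \o f).
Proof.
move=> mf fg; apply: le_integrable => //; first exact/measurable_EFinP.
by move=> x _ /=; rewrite lee_fin (le_trans (fg x))// ler_norm.
Qed.

Lemma bounded_integrable (mu : probability T R) (f : T -> R) (M : R) :
  measurable_fun [set: T] f -> (forall x, `|f x| <= M) ->
  mu.-integrable [set: T] (EFin \o f).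
Proof.
move=> mf fM; apply: (@ler_norm_integrable mu f (cst M)) => //.
exact: finite_measure_integrable_cst.
Qed.

Lemma EFin_Rintegral (mu : {measure set T -> \bar R}) (f : T -> R) :
  mu.-integrable [set: T] (EFin \o f) ->
  ((\int[mu]_x f x)%:E = \int[mu]_x (f x)%:E)%E.
Proof. by move=> fi; rewrite fineK//; exact: integrable_fin_num. Qed.

Lemma Rintegral_sum (mu : {measure set T -> \bar R}) (I : Type) (s : seq I)
    (f : I -> T -> R) : (forall i, mu.-integrable [set: T] (EFin \o f i)) ->
  \int[mu]_x (\sum_(i <- s) f i x) = \sum_(i <- s) \int[mu]_x f i x.
Proof.
move=> fi; rewrite /Rintegral.
under eq_integral do rewrite -sumEFin.
rewrite (integral_sum (mu := mu) measurableT fi).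
by rewrite -sum_fine// => i _; exact: integrable_fin_num.
Qed.

Lemma Rintegral_prob_cst (mu : probability T R) (c : R) :
  \int[mu]_(x in [set: T]) c = c.
Proof. rewrite Rintegral_cst//. by rewrite [X in fine X](probability_setT mu) mulr1. Qed.

Lemma Rintegral_itv01 (mu : probability T R) (f : T -> R) :
  measurable_fun [set: T] f -> (forall x, 0 <= f x <= 1) ->
  0 <= \int[mu]_x f x <= 1.
Proof.
move=> mf f01; rewrite Rintegral_ge0/=; last by move=> x _; case/andP: (f01 x).
have fi : mu.-integrable [set: T] (EFin \o f).
  by apply: (@bounded_integrable mu f 1) => // x; rewrite ger0_norm; case/andP: (f01 x).
rewrite -[leRHS](Rintegral_prob_cst mu) le_Rintegral//.
  exact: finite_measure_integrable_cst.
by move=> x _; case/andP: (f01 x).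
Qed.

End bounded_integrals.

(** * Change of measure for bounded signed functions *)

Section bounded_change_of_measure.
Set Implicit Arguments.
Unset Strict Implicit.
Context d d' (T : measurableType d) (T' : measurableType d') (R : realType).
Variables (nu : {measure set T -> \bar R}) (rho : probability T' R).
Variables (X : T -> T').
Hypothesis mX : measurable_fun [set: T] X.

(** The nonnegative case applies to [f + M], and the added mass [M * c] then cancels. Taking [W = 1]
    transports a law, [X = id] uses a density, and the general form serves the induction on
    independent coordinates. *)
Lemma Rintegral_weighted (W : T -> R) (c : R) (f : T' -> R) (M : R) :
  measurable_fun [set: T] W -> (forall x, 0 <= W x) ->
  (forall A, measurable A ->
    (\int[nu]_(x in X @^-1` A) (W x)%:E = c%:E * rho A)%E) ->
  measurable_fun [set: T'] f -> (forall y, `|f y| <= M) ->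
  nu.-integrable [set: T] (fun x => (f (X x) * W x)%:E) /\
  \int[nu]_x (f (X x) * W x) = c * \int[rho]_y f y.
Proof.
move=> mW W0 WX mf fM.
have mfX : measurable_fun [set: T] (f \o X) by exact: measurableT_comp.
have intW : (\int[nu]_x (W x)%:E = c%:E)%E.
  by have := WX _ measurableT; rewrite preimage_setT probability_setT mule1.
have iW : nu.-integrable [set: T] (EFin \o W).
  apply/integrableP; split; first exact/measurable_EFinP.
  under eq_integral do rewrite gee0_abs ?lee_fin//.
  by rewrite intW ltry.
have iMW : nu.-integrable [set: T] (EFin \o (fun x => M * W x)).
  exact: (integrableZl measurableT M iW).
have ifW : nu.-integrable [set: T] (EFin \o (fun x => f (X x) * W x)).
  apply: (ler_norm_integrable _ _ iMW) => [|x]; first exact: measurable_funM.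
  by rewrite normrM (ger0_norm (W0 x)) ler_wpM2r.
split=> //.
have if_ : rho.-integrable [set: T'] (EFin \o f) by exact: bounded_integrable fM.
have iM : rho.-integrable [set: T'] (EFin \o cst M).
  exact: finite_measure_integrable_cst.
have mfM : measurable_fun [set: T'] (fun y => (f y + M)%:E).
  exact/measurable_EFinP/measurable_funD.
have fM0 y : (0 <= (f y + M)%:E)%E.
  by rewrite lee_fin -lerBlDr sub0r lerNl (le_trans (ler_norm _))// normrN.
have := ge0_integral_weighted mX mW W0 WX mfM fM0.
move/(congr1 fine); rewrite fineM//; last first.
  by apply: integrable_fin_num => //; apply: integrableD if_ iM.
rewrite -[X in _ = _ * X -> _]/(\int[rho]_y (f y + M)).
rewrite RintegralD// Rintegral_prob_cst mulrDr.
have -> : fine (\int[nu]_x ((f (X x) + M)%:E * (W x)%:E))%E =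
    \int[nu]_x (f (X x) * W x + M * W x).
  by rewrite /Rintegral; under eq_integral do rewrite -EFinM mulrDl.
rewrite RintegralD// RintegralZl// [X in M * X](_ : _ = c); last first.
  by rewrite /Rintegral intW.
by rewrite [c * M]mulrC => /addIr.
Qed.

Lemma Rintegral_law (f : T' -> R) (M : R) :
  (forall A, measurable A -> nu (X @^-1` A) = rho A) ->
  measurable_fun [set: T'] f -> (forall y, `|f y| <= M) ->
  \int[nu]_x f (X x) = \int[rho]_y f y.
Proof.
move=> nuX mf fM.
have W1 A : measurable A ->
    (\int[nu]_(x in X @^-1` A) ((cst 1 : T -> R) x)%:E = 1%:E * rho A)%E.
  move=> mA; rewrite /cst/= integral_cst ?mul1e ?nuX//.
  by rewrite -[X in measurable X]setTI; exact: mX.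
have [||_] := Rintegral_weighted _ _ W1 mf fM => //.
by rewrite mul1r => <-; apply: eq_Rintegral => x _; rewrite mulr1.
Qed.

End bounded_change_of_measure.

(** * Elementary inequalities for [expR] and [ln] *)

Section convexity.
Set Implicit Arguments.
Unset Strict Implicit.
Context (R : realType).

(** Convexity of [expR]: the right-hand side is the chord joining the value 1 at [x = 0] to
    [expR (- a)] at [x = 1]. *)
Lemma expR_chord (a x : R) : 0 <= x <= 1 ->
  expR (- (a * x)) <= 1 - x + x * expR (- a).
Proof.
move=> /andP[x0 x1]; have := convex_expR (Itv01 x0 x1) (- a) 0.
rewrite !convRE/= mulr0 addr0 expR0 mulr1 /unstable.onem mulrN [x * a]mulrC.
by rewrite [leRHS]addrC.
Qed.

(** Fenchel-Young inequality for [expR] and its conjugate [f ln f - f]: multiply [1 + t <= expR t]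
    at [t = u - ln f] by [f]. At [f = 0] it only says that [expR u] is nonnegative. *)
Lemma young_expR_ln (f u : R) : 0 <= f ->
  f * u + f - expR u <= f * ln f.
Proof.
rewrite le_eqVlt => /predU1P[<-|f0].
  by rewrite !mul0r !add0r oppr_le0 expR_ge0.
have := expR_ge1Dx (u - ln f).
rewrite expRB lnK ?posrE// ler_pdivlMr//.
by move=> h; nra.
Qed.

(** Concavity of [ln], from [ln (1 + t) <= t] at [t = x / y - 1]. *)
Lemma ln_tangent (x y : R) : 0 < x -> 0 < y ->
  ln x <= ln y + (x - y) / y.
Proof.
move=> x0 y0; have := @le_ln1Dx R (x / y - 1).
rewrite addrCA subrr addr0 ltrBrDl subrr divr_gt0// => /(_ isT).
rewrite ln_div ?posrE// => h.
by rewrite mulrBl divff ?gt_eqF// -lerBlDl.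
Qed.

End convexity.

(** * Jensen's inequality for the negative logarithm *)

Section jensen.
Set Implicit Arguments.
Unset Strict Implicit.
Context d (T : measurableType d) (R : realType) (mu : probability T R).

(** Integrate the tangent inequality at the mean. Because [k < 1], the arguments of [ln] are at
    least [1 - k > 0], so the logarithm is bounded and hence integrable. *)
Lemma jensen_Nln (r : T -> R) (k : R) :
  measurable_fun [set: T] r -> (forall x, 0 <= r x <= 1) -> 0 <= k < 1 ->
  - ln (1 - k * \int[mu]_x r x) <= \int[mu]_x (- ln (1 - k * r x)).
Proof.
move=> mr r01 /andP[k0 k1].
have /andP[I0 I1] := Rintegral_itv01 mu mr r01.
set I := \int[mu]_x r x in I0 I1 *.
have ri : mu.-integrable [set: T] (EFin \o r).
  by apply: (@bounded_integrable _ _ _ mu r 1) => // x; rewrite ger0_norm; case/andP: (r01 x).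
have y0 : 0 < 1 - k * I by nra.
have x0 x : 1 - k <= 1 - k * r x <= 1 by have := r01 x; nra.
set y := 1 - k * I in y0 *.
have ci c : mu.-integrable [set: T] (EFin \o cst (c : R)).
  exact: finite_measure_integrable_cst.
(* The integrand on the right is the tangent of [- ln] at [y], evaluated at [1 - k * r x]; its mean
   is [- ln y]. *)
have -> : - ln y = \int[mu]_x (- ln y - I * k / y + k / y * r x).
  rewrite (RintegralD (f1 := cst (- ln y - I * k / y)))//; last first.
    exact: (integrableZl measurableT (k / y) ri).
  rewrite RintegralZl// Rintegral_prob_cst -/I.
  ring.
apply: le_Rintegral => //.
- exact: (integrableD measurableT (ci _) (integrableZl measurableT (k / y) ri)).
- apply: (@bounded_integrable _ _ _ mu _ (- ln (1 - k))).
    apply/measurable_funN/measurableT_comp => //.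
    by apply: measurable_funB => //; exact: measurable_funM.
  move=> x; have /andP[x1 x2] := x0 x.
  by rewrite normrN ler0_norm ?ln_le0// lerN2 ler_ln ?posrE; lra.
move=> x _; have /andP[x1 x2] := x0 x.
have xp : 0 < 1 - k * r x by lra.
have := ln_tangent xp y0.
rewrite -lerN2; apply: le_trans; rewrite le_eqVlt; apply/orP; left.
by apply/eqP; rewrite /y in y0 *; field; exact: lt0r_neq0.
Qed.

End jensen.

(** * The Donsker-Varadhan variational inequality *)

Section donsker_varadhan.
Set Implicit Arguments.
Unset Strict Implicit.
Context d (T : measurableType d) (R : realType).

(** Integrability is not assumed, because the integral of [f * ln f] defining [KL] may be infinite;
    positive and negative parts are compared separately. *)
Lemma le_integral_measurable (mu : {measure set T -> \bar R}) (f g : T -> \bar R) :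
  measurable_fun [set: T] f -> measurable_fun [set: T] g ->
  (forall x, (f x <= g x)%E) -> (\int[mu]_x f x <= \int[mu]_x g x)%E.
Proof.
move=> mf mg fg; rewrite [leLHS]integralE [leRHS]integralE leeB//.
- apply: ge0_le_integral => //; try exact: measurable_funepos.
  by move=> x _; apply: (@funepos_le _ _ setT) => [y _|]; [exact: fg|rewrite inE].
- apply: ge0_le_integral => //; try exact: measurable_funeneg.
  by move=> x _; apply: (@funeneg_le _ _ setT) => [y _|]; [exact: fg|rewrite inE].
Qed.

(** Without a density [KL] is infinite. With a density [f], integrate [f u + f - expR u <= f ln f]
    against [nu]: the mass 1 of [f] outweighs the integral of [expR u], which leaves at least the
    mean of [u] under [mu]. *)
Lemma donsker_varadhan (mu nu : probability T R) (u : T -> R) (M : R) :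
  measurable_fun [set: T] u -> (forall x, `|u x| <= M) ->
  (\int[nu]_x (expR (u x))%:E <= 1)%E ->
  ((\int[mu]_x u x)%:E <= KL mu nu)%E.
Proof.
move=> mu_ uM expu; rewrite /KL; case: pselect => [H|_]; last exact: leey.
case: cid => f [mf f0 hf] /=.
have hf1 A : measurable A ->
    (\int[nu]_(x in id @^-1` A) (f x)%:E = 1%:E * mu A)%E.
  by move=> mA; rewrite mul1e hf.
have [iuf ->] : nu.-integrable [set: T] (fun x => (u x * f x)%:E) /\
    \int[mu]_x u x = \int[nu]_x (u x * f x).
  by have [|] := Rintegral_weighted _ mf f0 hf1 mu_ uM => //; rewrite mul1r.
(* Testing against the constant 1 shows that the density is integrable with total mass 1. *)
have cst1 (x : T) : `|(cst 1 : T -> R) x| <= 1 by rewrite normr1.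
have [||if1 If1] := Rintegral_weighted _ mf f0 hf1 _ cst1 => //.
rewrite Rintegral_prob_cst mulr1 in If1.
have iexp : nu.-integrable [set: T] (EFin \o (fun x => expR (u x))).
  apply: (@bounded_integrable _ _ _ nu _ (expR M)); first exact: measurableT_comp.
  by move=> x; rewrite ger0_norm ?expR_ge0// ler_expR (le_trans (ler_norm _)).
have iv := integrableB measurableT (integrableD measurableT iuf if1) iexp.
apply: (@le_trans _ _ (\int[nu]_x (u x * f x + 1 * f x - expR (u x))%:E)%E).
  rewrite -EFin_Rintegral// lee_fin RintegralB//; last first.
    exact: (integrableD measurableT iuf if1).
  rewrite RintegralD// If1 -addrA lerDl subr_ge0 -lee_fin EFin_Rintegral//.
apply: le_integral_measurable.
- exact: measurable_int iv.
- by apply/measurable_EFinP/measurable_funM => //; exact: measurableT_comp.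
- by move=> x; rewrite lee_fin mul1r [u x * _]mulrC young_expR_ln.
Qed.

End donsker_varadhan.

(** * Product formula for independent variables *)

Section independence.
Set Implicit Arguments.
Unset Strict Implicit.
Context dO dZ (Omega : measurableType dO) (Z : measurableType dZ) (R : realType).
Variables (P : probability Omega R) (I : finType).
Variables (Y : I -> Omega -> Z) (rho : I -> probability Z R).
Hypotheses (mY : forall k, measurable_fun [set: Omega] (Y k))
  (Y_law : forall k A, measurable A -> P (Y k @^-1` A) = rho k A)
  (Y_indep : forall A : I -> set Z, (forall k, measurable (A k)) ->
     P (\bigcap_k (Y k @^-1` A k)) = (\prod_k P (Y k @^-1` A k))%E).

Lemma prod_indic (A : I -> set Z) (w : Omega) :
  \prod_k \1_(A k) (Y k w) = \1_(\bigcap_k (Y k @^-1` A k)) w :> R.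
Proof.
rewrite [RHS]indicE; case: (boolP (w \in _)) => [|nw].
  rewrite inE => wA; apply: big1 => k _.
  by rewrite indicE mem_set//; exact: wA.
have [k nk] : exists k, ~ A k (Y k w).
  apply/existsNP => h; move: nw; rewrite notin_setE; apply => k _; exact: h.
by rewrite (bigD1 k)//= indicE memNset// mul0r.
Qed.

(* Independence is the case where every factor is an indicator; the induction
   trades the indicators for bounded functions one coordinate at a time, since
   for fixed other factors both sides are measures in the set being indicated. *)
Lemma Rintegral_prod_indep (g : I -> Z -> R) :
  (forall k, measurable_fun [set: Z] (g k)) ->
  (forall k z, 0 <= g k z <= 1) ->
  \int[P]_w \prod_k g k (Y k w) = \prod_k \int[rho k]_z g k z.
Proof.
(* Coordinates outside [s] carry indicators; for [s = enum I] this constrains nothing. *)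
suff step (s : seq I) (h : I -> Z -> R) :
    (forall k, measurable_fun [set: Z] (h k)) ->
    (forall k z, 0 <= h k z <= 1) ->
    (forall k, k \notin s -> exists2 A, measurable A & h k = \1_A) ->
    \int[P]_w \prod_k h k (Y k w) = \prod_k \int[rho k]_z h k z.
  by move=> mg g01; apply: (step (enum I)) => // k; rewrite mem_enum.
elim: s h => [|i s IH] h mh h01 hs.
  have /choice[A hA] k : exists A, measurable A /\ h k = \1_A.
    by have [//|A mA hkA] := hs k; exists A.
  have mA k : measurable (A k) by case: (hA k).
  rewrite (eq_Rintegral P (g := fun w => \1_(\bigcap_k (Y k @^-1` A k)) w)); last first.
    move=> w _; rewrite -prod_indic; apply: eq_bigr => k _.
    by rewrite (hA k).2.
  have mYA k : measurable (Y k @^-1` A k).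
    by rewrite -[X in measurable X]setTI; exact: mY.
  rewrite {1}/Rintegral integral_indic//; last first.
    exact: fin_bigcap_measurable.
  rewrite setIT.
  transitivity (fine (\prod_k (fine (rho k (A k)))%:E)%E).
    congr fine; rewrite [LHS]Y_indep//; apply: eq_bigr => k _.
    by rewrite Y_law// fineK// fin_num_measure.
  rewrite prodEFin; apply: eq_bigr => k _.
  by rewrite (hA k).2 /Rintegral integral_indic// setIT.
pose W w := \prod_(k | k != i) h k (Y k w).
pose c := \prod_(k | k != i) \int[rho k]_z h k z.
have mhY k : measurable_fun [set: Omega] (fun w => h k (Y k w)).
  exact: measurableT_comp.
have mW : measurable_fun [set: Omega] W.
  rewrite /W; under eq_fun do rewrite -big_filter.
  exact: measurable_prod.
have W0 w : 0 <= W w by apply: prodr_ge0 => k _; case/andP: (h01 k (Y k w)).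
have W1 w : W w <= 1 by apply: prodr_ile1 => k _; exact: h01.
have hi1 z : `|h i z| <= 1 by rewrite ger0_norm; case/andP: (h01 i z).
rewrite (eq_Rintegral P (g := fun w => h i (Y i w) * W w)); last first.
  by move=> w _; rewrite (bigD1 i).
rewrite [RHS](bigD1 i)//= mulrC -/c.
(* With the other factors frozen into the weight [W], a bounded [h i] can be replaced by
   indicators. *)
suff WY A : measurable A -> (\int[P]_(w in Y i @^-1` A) (W w)%:E = c%:E * rho i A)%E.
  by have [] := Rintegral_weighted (mY i) mW W0 WY (mh i) hi1.
(* Putting [\1_A] at coordinate [i] removes [i] from the list of unrestricted coordinates, so the
   induction hypothesis applies. *)
move=> mA; pose h' k := if k == i then \1_A else h k.
have h'i k : k != i -> h' k = h k by rewrite /h' => /negbTE ->.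
have h'ii : h' i = \1_A by rewrite /h' eqxx.
have ind01 z : 0 <= (\1_A z : R) <= 1 by rewrite indicE; case: (_ \in _); rewrite ?lexx ler01.
have : \int[P]_w \prod_k h' k (Y k w) = \prod_k \int[rho k]_z h' k z.
  apply: IH => [k|k z|k ks]; have [->|ki] := eqVneq k i; rewrite ?h'ii ?h'i//.
  - by exists A.
  - by apply: hs; rewrite inE negb_or ki.
rewrite (eq_Rintegral P (g := fun w => \1_A (Y i w) * W w)); last first.
  move=> w _; rewrite (bigD1 i)//= h'ii; congr (_ * _).
  by apply: eq_bigr => k ki; rewrite h'i.
rewrite [X in _ = X](bigD1 i)//= h'ii.
rewrite (eq_bigr (fun k => \int[rho k]_z h k z)) -/c; last first.
  by move=> k ki; rewrite h'i.
rewrite [X in _ = X * _ -> _]/Rintegral integral_indic// setIT => hA.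
have iW : P.-integrable [set: Omega] (EFin \o (fun w => \1_A (Y i w) * W w)).
  apply: (@bounded_integrable _ _ _ P _ 1) => [|w].
    by apply: measurable_funM => //; apply: measurableT_comp (mY i); exact: measurable_indic.
  have /andP[? ?] := ind01 (Y i w).
  by rewrite ger0_norm ?mulr_ge0// mulr_ile1.
rewrite integral_mkcond -[rho i A]fineK ?fin_num_measure// -EFinM mulrC -hA EFin_Rintegral//.
apply: eq_integral => w _; rewrite patchE indicE (_ : (w \in _) = (Y i w \in A)).
  by case: ifPn => _; rewrite ?mul1r ?mul0r.
by apply/idP/idP; rewrite !inE.
Qed.

End independence.

(** * Exponential moments of losses in [0, 1] *)

Section exponential_moments.
Set Implicit Arguments.
Unset Strict Implicit.
Context dO dZ (Omega : measurableType dO) (Z : measurableType dZ) (R : realType).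

(** The integrated chord bound. The right-hand side is the Laplace transform at [a] of a Bernoulli
    variable with the same mean as [g]. *)
Lemma Rintegral_expRN_le (D : probability Z R) (g : Z -> R) (a : R) :
  measurable_fun [set: Z] g -> (forall z, 0 <= g z <= 1) -> 0 <= a ->
  \int[D]_z expR (- (a * g z)) <= 1 - (1 - expR (- a)) * \int[D]_z g z.
Proof.
move=> mg g01 a0.
have gi : D.-integrable [set: Z] (EFin \o g).
  by apply: (@bounded_integrable _ _ _ D g 1) => // z; rewrite ger0_norm; case/andP: (g01 z).
have i1 : D.-integrable [set: Z] (EFin \o cst (1 : R)).
  exact: finite_measure_integrable_cst.
have ci : D.-integrable [set: Z] (EFin \o (fun z => (1 - expR (- a)) * g z)).
  exact: (integrableZl measurableT _ gi).
rewrite -RintegralZl// -[X in X - _](Rintegral_prob_cst D) -RintegralB//.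
apply: le_Rintegral => //.
- apply: (@bounded_integrable _ _ _ D _ 1).
    by do 2 apply: measurableT_comp => //; exact: measurable_funM.
  move=> z; have /andP[? ?] := g01 z.
  by rewrite ger0_norm ?expR_ge0// expR_le1 oppr_le0 mulr_ge0.
- exact: (integrableB measurableT i1 ci).
- move=> z _; rewrite (le_trans (expR_chord a (g01 z)))// le_eqVlt.
  by apply/orP; left; apply/eqP; ring.
Qed.

(** The exponential of the sum is a product of independent factors, each divided by the Bernoulli
    bound [b k] on its own expectation, so every factor has mean at most 1. *)
Lemma Rintegral_expR_sum_le1 (P : probability Omega R) (I : finType)
    (Y : I -> Omega -> Z) (rho : I -> probability Z R)
    (g : I -> Z -> R) (a : I -> R) :
  (forall k, measurable_fun [set: Omega] (Y k)) ->
  (forall k A, measurable A -> P (Y k @^-1` A) = rho k A) ->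
  (forall A : I -> set Z, (forall k, measurable (A k)) ->
     P (\bigcap_k (Y k @^-1` A k)) = (\prod_k P (Y k @^-1` A k))%E) ->
  (forall k, measurable_fun [set: Z] (g k)) ->
  (forall k z, 0 <= g k z <= 1) -> (forall k, 0 <= a k) ->
  \int[P]_w expR (\sum_k (- ln (1 - (1 - expR (- a k)) * \int[rho k]_z g k z)
                          - a k * g k (Y k w))) <= 1.
Proof.
move=> mY Y_law Y_indep mg g01 a0.
pose b k := 1 - (1 - expR (- a k)) * \int[rho k]_z g k z.
have b0 k : 0 < b k.
  have /andP[? ?] := Rintegral_itv01 (rho k) (mg k) (g01 k).
  by have := expR_gt0 (- a k); rewrite /b; nra.
pose h k z := expR (- (a k * g k z)).
have mh k : measurable_fun [set: Z] (h k).
  by do 2 apply: measurableT_comp => //; exact: measurable_funM.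
have h01 k z : 0 <= h k z <= 1.
  have /andP[? ?] := g01 k z.
  by rewrite expR_ge0 expR_le1 oppr_le0 mulr_ge0.
rewrite (eq_Rintegral P (g := fun w => \prod_k (b k)^-1 * \prod_k h k (Y k w))).
  rewrite RintegralZl//; last first.
    apply: (@bounded_integrable _ _ _ P _ 1) => [|w].
      by apply: measurable_prod => k _; exact: measurableT_comp.
    rewrite ger0_norm; first by apply: prodr_ile1 => k _; exact: h01.
    by apply: prodr_ge0 => k _; rewrite expR_ge0.
  rewrite (Rintegral_prod_indep mY Y_law Y_indep mh h01) -big_split/=.
  apply: prodr_ile1 => k _; apply/andP; split.
    rewrite mulr_ge0 ?invr_ge0 ?(ltW (b0 k))//.
    by apply: Rintegral_ge0 => z _; rewrite expR_ge0.
  by rewrite mulrC ler_pdivrMr// mul1r Rintegral_expRN_le.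
move=> w _; rewrite expR_sum -big_split/=; apply: eq_bigr => k _.
by rewrite expRD expRN lnK// posrE; exact: b0.
Qed.

End exponential_moments.

(** * Exchange of the averages over predictors and samples *)

Section fubini_bounded.
Set Implicit Arguments.
Unset Strict Implicit.
Context d1 d2 (T1 : measurableType d1) (T2 : measurableType d2) (R : realType).
Variable l : T1 -> T2 -> R.
Hypothesis ml : measurable_fun [set: T1 * T2] (fun p => l p.1 p.2).
Hypothesis l01 : forall x y, 0 <= l x y <= 1.

Lemma measurable_Rintegral (D : probability T2 R) :
  measurable_fun [set: T1] (fun x => \int[D]_y l x y).
Proof.
apply: measurableT_comp => //.
apply: (measurable_fun_fubini_tonelli_F (m2 := D) (fun p => (l p.1 p.2)%:E)).
  exact/measurable_EFinP.
by move=> x; rewrite lee_fin; case/andP: (l01 x.1 x.2).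
Qed.

(** [risk] averages over predictors first; Jensen's inequality needs the risk of each single
    predictor as the inner integral. *)
Lemma risk_swap (D : probability T2 R) (Q : probability T1 R) :
  risk l D Q = \int[Q]_x \int[D]_y l x y.
Proof.
have mlx x : measurable_fun [set: T2] (l x) by exact: (measurableT_comp ml (measurable_pair1 x)).
have mly y : measurable_fun [set: T1] (l ^~ y).
  exact: (measurableT_comp ml (measurable_pair2 y)).
have ilx x : D.-integrable [set: T2] (EFin \o l x).
  by apply: (@bounded_integrable _ _ _ D _ 1) => // y; rewrite ger0_norm; case/andP: (l01 x y).
have ily y : Q.-integrable [set: T1] (EFin \o l ^~ y).
  by apply: (@bounded_integrable _ _ _ Q _ 1) => // x; rewrite ger0_norm; case/andP: (l01 x y).
congr fine.
rewrite (eq_integral (fun y => \int[Q]_x (l x y)%:E)%E); last first.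
  by move=> y _; rewrite -EFin_Rintegral.
under [RHS]eq_integral => x _ do rewrite EFin_Rintegral//.
apply/esym/(fubini_tonelli (m1 := Q) (m2 := D) (fun p => (l p.1 p.2)%:E)).
  exact/measurable_EFinP.
by move=> x; rewrite lee_fin; case/andP: (l01 x.1 x.2).
Qed.

End fubini_bounded.

(** * The high-probability event *)

Section markov_event.
Set Implicit Arguments.
Unset Strict Implicit.
Context d1 d2 (T1 : measurableType d1) (T2 : measurableType d2) (R : realType).

(** Tonelli bounds the mean of [G] by 1, and Markov discards the set where [G] reaches [1 / delta].
    The shift by [ln delta] rescales the remaining bound to 1, the form required by
    [donsker_varadhan]. *)
Lemma exp_moment_event (P : probability T1 R) (PP : probability T2 R)
    (V : T1 * T2 -> R) (delta : R) : 0 < delta ->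
  measurable_fun [set: T1 * T2] V ->
  (forall t, (\int[P]_w (expR (V (w, t)))%:E <= 1)%E) ->
  exists E : set T1, [/\ measurable E, ((1 - delta)%:E <= P E)%E &
    forall w, E w -> (\int[PP]_t (expR (V (w, t) + ln delta))%:E <= 1)%E].
Proof.
move=> d0 mV V1.
pose f p := (expR (V p))%:E.
have mf : measurable_fun [set: T1 * T2] f.
  by apply/measurable_EFinP; exact: measurableT_comp.
have f0 p : (0 <= f p)%E by rewrite lee_fin expR_ge0.
pose G w := (\int[PP]_t f (w, t))%E.
have mG : measurable_fun [set: T1] G.
  exact: measurable_fun_fubini_tonelli_F.
have G0 w : (0 <= G w)%E by exact: integral_ge0.
have IG : (\int[P]_w G w <= 1)%E.
  rewrite (fubini_tonelli (m1 := P) (m2 := PP) f)//.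
  rewrite -[leRHS](probability_setT PP) -[leRHS]mul1e -integral_cst//.
  apply: ge0_le_integral => //.
  - by move=> t _; exact: integral_ge0.
  - exact: measurable_fun_fubini_tonelli_G.
  - by move=> t _; exact: V1.
pose B := [set: T1] `&` [set w | (`|G w| >= (delta^-1)%:E)%E].
have mB : measurable B.
  by apply: emeasurable_fun_c_infty => //; exact: measurableT_comp.
have PB : (P B <= delta%:E)%E.
  have di0 : 0 < delta^-1 by rewrite invr_gt0.
  (* Markov's inequality, with the identity as the nondecreasing function. *)
  have := @le_integral_comp_abse _ _ _ P _ measurableT G (delta^-1) id
    (@measurable_id _ _ _) (fun _ => id) (fun _ _ _ _ => id) mG di0.
  rewrite (eq_integral G) => [h|w _]; last by rewrite gee0_abs.
  have := le_trans h IG.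
  by rewrite lee_pdivrMl// mule1.
exists (~` B); split.
- exact: measurableC.
- by rewrite probability_setC// EFinB leeB.
- move=> w /= nB; have Gw : (G w <= (delta^-1)%:E)%E.
    rewrite leNgt; apply/negP => h; apply: nB; split => //=.
    by rewrite gee0_abs// ltW.
  under eq_integral do rewrite expRD lnK// mulrC EFinM.
  rewrite ge0_integralZl_EFin ?(ltW d0)//; last first.
    exact: measurableT_comp mf _.
  have -> : (1 = delta%:E * (delta^-1)%:E)%E.
    by rewrite -EFinM divff// gt_eqF.
  by rewrite lee_pmul2l// lte_fin.
Qed.

End markov_event.

(** Use the box equal to [A] in coordinate [i] and to the whole space elsewhere. These marginals
    suffice later because each summand of the exponent depends on one predictor. *)
Lemma frakQ_tnth_law dF (F : measurableType dF) (R : realType) (n : nat)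
    (Qh : probability (pprobability F R) R) (Q : 'I_n -> probability F R)
    (QQ : probability (pprobability F R * n.-tuple F)%type R) (i : 'I_n)
    (A : set F) :
  is_frakQ Qh Q QQ -> measurable A ->
  QQ ((fun t => tnth t.2 i) @^-1` A) = Q i A.
Proof.
move=> hQ mA; pose B j := if j == i then A else setT.
have mB j : measurable (B j) by rewrite /B; case: ifP.
have -> : (fun t : pprobability F R * n.-tuple F => tnth t.2 i) @^-1` A =
    setT `*` box B.
  apply/seteqP; split=> [t /= tA|t [_ /(_ i)]]; last by rewrite /B eqxx.
  by split=> // j; rewrite /B; case: eqP => // ->.
rewrite hQ// probability_setT mul1e (bigD1 i)//= {1}/B eqxx big1 ?mule1// => j.
by rewrite /B => /negbTE ->; rewrite probability_setT.
Qed.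

(** * The contribution of one sample to the exponent *)

Section task_term.
Set Implicit Arguments.
Unset Strict Implicit.
Context dF dZ (F : measurableType dF) (Z : measurableType dZ) (R : realType).
Variables (l : F -> Z -> R) (D : probability Z R) (a : R).
Hypothesis ml : measurable_fun [set: F * Z] (fun p => l p.1 p.2).
Hypothesis l01 : forall f z, 0 <= l f z <= 1.
Hypothesis a0 : 0 <= a.

(** The logarithmic part is the normalisation that makes the exponential have mean at most 1 when
    [z] is drawn from [D]. *)
Definition task_term (f : F) (z : Z) : R :=
  - ln (1 - (1 - expR (- a)) * \int[D]_x l f x) - a * l f z.

Let mlf (z : Z) : measurable_fun [set: F] (l ^~ z).
Proof. exact: (measurableT_comp ml (measurable_pair2 z)). Qed.

Let r01 (f : F) : 0 <= \int[D]_x l f x <= 1.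
Proof.
by apply: Rintegral_itv01 => //; exact: (measurableT_comp ml (measurable_pair1 f)).
Qed.

Let k01 : 0 <= 1 - expR (- a) < 1.
Proof. by rewrite subr_ge0 expR_le1 oppr_le0 a0 ltrBlDr ltrDl expR_gt0. Qed.

Let mNln : measurable_fun [set: F]
  (fun f => - ln (1 - (1 - expR (- a)) * \int[D]_x l f x)).
Proof.
apply/measurable_funN/measurableT_comp => //; apply: measurable_funB => //.
by apply: measurable_funM => //; exact: measurable_Rintegral.
Qed.

Lemma measurable_task_term :
  measurable_fun [set: F * Z] (fun p => task_term p.1 p.2).
Proof.
apply: measurable_funB; first exact: (measurableT_comp mNln measurable_fst).
exact: measurable_funM.
Qed.

(** The argument of [ln] lies between [expR (- a)] and 1. *)
Let Nln_bound f : `|- ln (1 - (1 - expR (- a)) * \int[D]_x l f x)| <= a.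
Proof.
have /andP[? ?] := r01 f; have /andP[? ?] := k01; have ? := expR_gt0 (- a).
rewrite normrN ler0_norm ?ln_le0//; last by nra.
by rewrite lerNl -[leLHS]expRK ler_ln ?posrE//; nra.
Qed.

Let al_bound f z : `|a * l f z| <= a.
Proof.
by have /andP[? ?] := l01 f z; rewrite ger0_norm ?mulr_ge0// ler_piMr.
Qed.

Lemma task_term_bound f z : `|task_term f z| <= 2 * a.
Proof.
rewrite (le_trans (ler_normB _ _))// mulr_natl mulr2n.
by rewrite lerD ?Nln_bound ?al_bound.
Qed.

(** The loss part is linear in [Q], hence exact; after exchanging the integrals in [risk], Jensen
    handles the logarithmic part. *)
Lemma Rintegral_task_term_ge (Q : probability F R) (z : Z) :
  - ln (1 - (1 - expR (- a)) * risk l D Q) - a * lossQ l Q z <=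
  \int[Q]_f task_term f z.
Proof.
have il : Q.-integrable [set: F] (EFin \o l ^~ z).
  apply: (@bounded_integrable _ _ _ Q _ 1) => // f.
  by rewrite ger0_norm; case/andP: (l01 f z).
have ial : Q.-integrable [set: F] (EFin \o (fun f => a * l f z)).
  exact: (integrableZl measurableT a il).
have iN := @bounded_integrable _ _ _ Q _ _ mNln Nln_bound.
rewrite RintegralB// RintegralZl// lerB//.
rewrite risk_swap//; apply: jensen_Nln => //.
exact: measurable_Rintegral.
Qed.

End task_term.

(** * Assembly of the bound over the pooled samples of all tasks *)

Theorem theorem4 (R : realType)
  (dF dZ dO : measure_display)
  (F : measurableType dF) (Z : measurableType dZ) (Omega : measurableType dO)
  (n : nat) (hn : (0 < n)%N)
  (D : 'I_n -> probability Z R)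
  (loss : 'I_n -> F -> Z -> R)
  (hloss_meas : forall i, measurable_fun [set: (F * Z)%type]
                             (fun p => loss i p.1 p.2))
  (hloss01 : forall i f z, 0 <= loss i f z <= 1)
  (m : 'I_n -> nat) (hm : forall i, (0 < m i)%N)
  (P : probability Omega R)
  (X : forall i : 'I_n, 'I_(m i) -> Omega -> Z)
  (hX : iid_samples P D X)
  (Ph : probability (pprobability F R) R)
  (PP : probability (pprobability F R * n.-tuple F)%type R)
  (hPP : is_frakP Ph PP)
  (delta : R) (hdelta : 0 < delta)
  (lambda : 'I_n -> R) (hlambda : forall i, 0 < lambda i) :
  exists E : set Omega,
    [/\ measurable E, ((1 - delta)%:E <= P E)%E &
    forall w, E w ->
    forall (Qh : probability (pprobability F R) R)
           (Q : 'I_n -> probability F R)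
           (QQ : probability (pprobability F R * n.-tuple F)%type R),
      is_frakQ Qh Q QQ ->
      ((- \sum_(i < n) (m i)%:R *
          ln (1 - risk (loss i) (D i) (Q i)
                + risk (loss i) (D i) (Q i)
                  * expR (- (lambda i / (n%:R * (m i)%:R)))))%:E
       <= ((n%:R)^-1 * \sum_(i < n) lambda i *
             emp_risk (loss i) (fun j => X i j w) (Q i))%:E
          + KL QQ PP + (ln (delta^-1))%:E)%E].
Proof.
have [mX X_law X_indep] := hX.
pose a i := lambda i / (n%:R * (m i)%:R).
have a0 i : 0 <= a i by rewrite divr_ge0 ?(ltW (hlambda i))// mulr_ge0.
pose K := sample_index m.
pose Y (k : K) := X (tag k) (tagged k).
pose term (k : K) := task_term (loss (tag k)) (D (tag k)) (a (tag k)).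
pose T := (pprobability F R * n.-tuple F)%type.
pose V (p : Omega * T) := \sum_(k : K) term k (tnth p.2.2 (tag k)) (Y k p.1).
have mcoord i : measurable_fun [set: T]
    (fun t => tnth t.2 i).
  exact: (measurableT_comp (measurable_tnth i) measurable_snd).
have mV : measurable_fun [set: Omega * T] V.
  apply: measurable_sum => k.
  apply: (measurableT_comp (f := fun p => term k p.1 p.2)
    (g := fun p => (tnth p.2.2 (tag k), Y k p.1))).
    exact: measurable_task_term.
  apply/measurable_fun_pairP; split.
    exact: (measurableT_comp (mcoord _) measurable_snd).
  exact: (measurableT_comp (mX _ _) measurable_fst).
pose M := \sum_(k : K) 2 * a (tag k).
have VM p : `|V p| <= M.
  by rewrite (le_trans (ler_norm_sum _ _ _))// ler_sum// => k _; exact: task_term_bound.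
have V1 t : (\int[P]_w (expR (V (w, t)))%:E <= 1)%E.
  have expVM w : `|expR (V (w, t))| <= expR M.
    by rewrite ger0_norm ?expR_ge0// ler_expR (le_trans (ler_norm _)).
  rewrite -EFin_Rintegral; last first.
    apply: (bounded_integrable _ _ expVM); apply: measurableT_comp => //.
    exact: (measurableT_comp mV (measurable_pair2 t)).
  rewrite lee_fin.
  apply: (@Rintegral_expR_sum_le1 _ _ _ _ _ P K Y (fun k => D (tag k))
    (fun k => loss (tag k) (tnth t.2 (tag k))) (fun k => a (tag k))) => //.
  - by move=> k; exact: mX.
  - by move=> k A mA; exact: X_law.
  (* Joint independence of the pooled family, read off at the full index set. *)
  - move=> A mA; have := X_indep [set: K]%SET A mA.
    under [in RHS]eq_bigl do rewrite finset.in_setT.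
    rewrite (_ : [set k | k \in _] = setT)//.
    by apply/seteqP; split => k //= _; rewrite finset.in_setT.
  - by move=> k; exact: (measurableT_comp (hloss_meas _) (measurable_pair1 _)).
have [E [mE PE hE]] := exp_moment_event PP hdelta mV V1.
(* [E] is fixed before any posterior is introduced, so the bound is simultaneous over all of
   them. *)
exists E; split=> // w Ew Qh Q QQ hQ.
have term_bound k f : `|term k f (Y k w)| <= 2 * a (tag k) by exact: task_term_bound.
have mterm k : measurable_fun [set: F] (fun f => term k f (Y k w)).
  have mk := measurable_task_term (D (tag k)) (a (tag k)) (hloss_meas (tag k)) (hloss01 (tag k)).
  exact: (measurableT_comp mk (measurable_pair2 (Y k w))).
pose coord_term (k : K) (t : T) :=
  term k (tnth t.2 (tag k)) (Y k w).
have iterm k : QQ.-integrable setT (EFin \o coord_term k).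
  apply: bounded_integrable (fun t => term_bound k _).
  exact: (measurableT_comp (mterm k) (mcoord _)).
have Iterm k : \int[QQ]_t coord_term k t = \int[Q (tag k)]_f term k f (Y k w).
  apply: (Rintegral_law (mcoord _) _ (mterm k) (term_bound k)) => A mA.
  exact: frakQ_tnth_law hQ mA.
pose u t := V (w, t) + ln delta.
have mu_ : measurable_fun setT u.
  apply: measurable_funD => //.
  exact: (measurableT_comp mV (measurable_pair1 w)).
have uM t : `|u t| <= M + `|ln delta|.
  by rewrite (le_trans (ler_normD _ _))// lerD2r.
have KLu := donsker_varadhan QQ mu_ uM (hE w Ew).
have Iu : \int[QQ]_t u t =
    \sum_k \int[Q (tag k)]_f term k f (Y k w) + ln delta.
  rewrite RintegralD//; last 2 first.
  - apply: bounded_integrable (fun t => VM (w, t)).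
    exact: (measurableT_comp mV (measurable_pair1 w)).
  - exact: finite_measure_integrable_cst.
  rewrite Rintegral_prob_cst Rintegral_sum//.
  by congr (_ + _); apply: eq_bigr => k _; exact: Iterm.
(* A sum over pooled samples is a double sum over tasks and positions. *)
have sumK (f : forall i, 'I_(m i) -> R) :
    \sum_(k : K) f (tag k) (tagged k) = \sum_i \sum_j f i j.
  by rewrite (sig_big_dep xpredT (fun _ => xpredT)).
have nm0 i : n%:R * (m i)%:R != 0 :> R.
  by rewrite mulf_neq0// pnatr_eq0 -lt0n.
set L := - _; set S := _^-1 * _.
have : L - S - ln (delta^-1) <= \int[QQ]_t u t.
  rewrite Iu lnV ?posrE// opprK lerD2r.
  (* The logarithmic term does not depend on the position [j], so its [m i] copies produce the
     factor [m i]. *)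
  have -> : L = \sum_(k : K) - ln (1 - (1 - expR (- a (tag k))) *
      risk (loss (tag k)) (D (tag k)) (Q (tag k))).
    rewrite (sumK (fun i _ => - ln (1 - (1 - expR (- a i)) * risk (loss i) (D i) (Q i)))).
    rewrite /L -sumrN; apply: eq_bigr => i _.
    rewrite sumr_const card_ord -[RHS]mulr_natl mulrN; congr (- (_ * ln _)).
    by rewrite /a; ring.
  (* The factor [1 / m i] of the empirical risk and the global [1 / n] combine with [lambda i] into
     [a i]. *)
  have -> : S = \sum_(k : K) a (tag k) * lossQ (loss (tag k)) (Q (tag k)) (Y k w).
    rewrite (sumK (fun i j => a i * lossQ (loss i) (Q i) (X i j w))).
    rewrite /S mulr_sumr; apply: eq_bigr => i _.
    rewrite -mulr_sumr /emp_risk /a; field.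
    by have := nm0 i; rewrite mulf_eq0 negb_or andbC.
  rewrite -sumrB; apply: ler_sum => k _; exact: Rintegral_task_term_ge.
rewrite -lee_fin => /le_trans/(_ KLu) h.
(* Since [KL] may be infinite, the real [L] is split into three finite terms, the middle one bounded
   by [KL], rather than subtracting in the extended reals. *)
have -> : L%:E = (S%:E + (L - S - ln delta^-1)%:E + (ln delta^-1)%:E)%E.
  by rewrite -!EFinD; congr EFin; ring.
by rewrite leeD2r// leeD2l.
Qed.
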